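(* For each fixed integer $d\ge 2$, the function $(m,n)\mapsto E_d(m,n)$ is piecewise quasi-polynomial in $(m,n)$ on $\{(m,n)\in\mathbb{Z}^2: m,n\ge 1\}$.
   Context: $G_{m,n}$ is the $m\times n$ grid graph with cells $(i,j)$, $1\le i\le m$, $1\le j\le n$, two cells adjacent when they differ by one in a single coordinate. A height function on $G_{m,n}$ is a map $h\colon G_{m,n}\to\mathbb{Z}$ with $|h(u)-h(v)|=1$ on every edge $uv$ and $h(1,1)=0$. A cell is a strict local minimum (maximum) if every neighbour has value larger (smaller) by one; the extrema of $h$ are its strict local minima and maxima. $E_d(m,n)$ is the number of height functions on $G_{m,n}$ with exactly $d$ extrema. (On the single grid $G_{1,1}$ the lone cell is vacuously both a minimum and a maximum; $E_d(1,1)$ is just one constant value.) A function $g\colon\mathbb{Z}^k\to\mathbb{Z}$ is a quasi-polynomial if there is a period such that $g$ agrees with a polynomial (with rational coefficients) on each residue class of $\mathbb{Z}^k$ modulo that period. It is piecewise quasi-polynomial if $\mathbb{R}^k$ can be split into finitely many regions cut out by linear inequalities such that $g$ agrees with a quasi-polynomial on the integer points of each region; ''on $\{m,n\ge1\}$'' means the same with this set being split. *)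

(* Defs.v *)
From mathcomp Require Import all_boot all_order all_algebra.
From mathcomp Require Import finmap.
From mathcomp Require Import boolp classical_sets functions cardinality reals.
From mathcomp Require Import mpoly.
From mathcomp Require Import zify.

Set Implicit Arguments.
Unset Strict Implicit.
Unset Printing Implicit Defensive.

Import Order.TTheory GRing.Theory Num.Theory.

Local Open Scope classical_set_scope.
Local Open Scope ring_scope.

(* Cells are 0-based: the cell (i, j) of the mathematical grid is the pair with
   values (i - 1, j - 1), so the corner (1, 1) is the cell with values (0, 0). *)
Definition cell (m n : nat) := ('I_m * 'I_n)%type.

Definition consecutive (a b : nat) : bool := (b == a.+1) || (a == b.+1).

Definition grid_adj (m n : nat) (u v : cell m n) : bool :=
  (u.1 == v.1) && consecutive u.2 v.2 || consecutive u.1 v.1 && (u.2 == v.2).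

Definition is_height_function (m n : nat) (h : {ffun cell m n -> int}) : Prop :=
  (forall u v : cell m n, grid_adj u v -> `|h u - h v| = 1) /\
  (forall u : cell m n, u.1 = 0%N :> nat -> u.2 = 0%N :> nat -> h u = 0).

Definition is_local_min (m n : nat) (h : {ffun cell m n -> int})
    (u : cell m n) : bool :=
  [forall v : cell m n, grid_adj u v ==> (h v == h u + 1)].

Definition is_local_max (m n : nat) (h : {ffun cell m n -> int})
    (u : cell m n) : bool :=
  [forall v : cell m n, grid_adj u v ==> (h v == h u - 1)].

Definition extrema (m n : nat) (h : {ffun cell m n -> int}) :
    {set cell m n} :=
  [set u | is_local_min h u || is_local_max h u]%SET.

Definition height_functions_with (d m n : nat) : set {ffun cell m n -> int} :=
  [set h | is_height_function h /\ #|extrema h| = d].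
Arguments height_functions_with : clear implicits.

(* [fset_set] returns the empty set on infinite sets; this case does not occur,
   see [finite_height_functions_with] below. *)
Definition E (d m n : nat) : nat := #|` fset_set (height_functions_with d m n)|.

Lemma height_function_bound (m n : nat) (h : {ffun cell m n -> int}) :
  is_height_function h -> forall u : cell m n, (`|h u| <= u.1 + u.2)%N.
Proof.
move=> [h1 h0].
suff H s (u : cell m n) : (u.1 + u.2 = s)%N -> (`|h u| <= s)%N.
  by move=> u; apply: H.
elim: s u => [|s IHs] [[i im] [j jn]] /= es.
  by rewrite h0 //=; lia.
case: i im es => [|i] im es.
  case: j jn es => [|j] jn es; first by [].
  have jn' : (j < n)%N by lia.
  have /= := IHs (Ordinal im, Ordinal jn') ltac:(simpl; lia).
  have := h1 (Ordinal im, Ordinal jn') (Ordinal im, Ordinal jn).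
  by rewrite /grid_adj /consecutive !eqxx /= => /(_ isT); lia.
have im' : (i < m)%N by lia.
have /= := IHs (Ordinal im', Ordinal jn) ltac:(simpl; lia).
have := h1 (Ordinal im', Ordinal jn) (Ordinal im, Ordinal jn).
by rewrite /grid_adj /consecutive !eqxx /= orbT => /(_ isT); lia.
Qed.

Lemma finite_height_functions_with (d m n : nat) :
  finite_set (height_functions_with d m n).
Proof.
pose F (k : {ffun cell m n -> 'I_((m + n).*2.+1)}) : {ffun cell m n -> int} :=
  [ffun u => (k u : nat)%:Z - (m + n)%:Z].
apply: (@sub_finite_set _ _ (F @` setT)); last exact/finite_image/finite_finset.
move=> h [hh _]; exists [ffun u => inord (absz (h u + (m + n)%:Z))] => //.
apply/ffunP => u; rewrite !ffunE.
have := height_function_bound hh u; have := ltn_ord u.1; have := ltn_ord u.2.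
move: (h u) (u.1 : nat) (u.2 : nat) => x i j jn im xij.
by rewrite inordK; lia.
Qed.

Definition quasi_polynomial (k : nat) (g : 'rV[int]_k -> int) : Prop :=
  exists2 N : nat, (0 < N)%N &
  forall r : 'rV[int]_k, exists p : {mpoly rat[k]},
  forall z : 'rV[int]_k, (forall i, (z ord0 i = r ord0 i %[mod N%:Z])%Z) ->
  (g z)%:~R = p.@[fun i => (z 0 i)%:~R].

(* The inequality a . x <= b, or a . x < b when the boolean is false. *)
Record linear_inequality (R : realType) (k : nat) := LinearInequality {
  li_coef : 'rV[R]_k;
  li_bound : R;
  li_weak : bool
}.

Definition satisfies (R : realType) (k : nat) (c : linear_inequality R k)
    (x : 'rV[R]_k) : bool :=
  \sum_(i < k) li_coef c 0 i * x 0 i < li_bound c ?<= if li_weak c.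

Definition region (R : realType) (k : nat) (s : seq (linear_inequality R k)) :
    set 'rV[R]_k :=
  [set x | all (fun c => satisfies c x) s].

Definition int_point (R : realType) (k : nat) (z : 'rV[int]_k) : 'rV[R]_k :=
  map_mx intr z.

(* D is partitioned by finitely many regions. Only the values of g at the
   integer points of D matter; D = setT gives the notion on the whole space. *)
Definition piecewise_quasi_polynomial_on (R : realType) (k : nat)
    (D : set 'rV[R]_k) (g : 'rV[int]_k -> int) : Prop :=
  exists (l : nat) (P : 'I_l -> seq (linear_inequality R k)),
    (forall x, D x -> exists! i, region (P i) x) /\
    (forall i, exists2 q : 'rV[int]_k -> int, quasi_polynomial q &
       forall z, D (int_point R z) -> region (P i) (int_point R z) ->
         g z = q z).

Definition ge1_quadrant (R : realType) : set 'rV[R]_2 :=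
  [set x : 'rV[R]_2 | 1 <= x 0 0 /\ 1 <= x 0 1].
Arguments ge1_quadrant : clear implicits.

(* Main.v *)
Require Import Defs.
From mathcomp Require Import all_boot all_order all_algebra.
From mathcomp Require Import finmap boolp classical_sets cardinality reals.
From mathcomp Require Import mpoly zify ring.

Set Implicit Arguments.
Unset Strict Implicit.
Unset Printing Implicit Defensive.

Import Order.TTheory GRing.Theory Num.Theory.
Local Open Scope ring_scope.

(** Call the horizontal strip between rows [i] and [i + 1] flat when all its
vertical steps are equal.  If two consecutive strips are flat with the same
step, the row between them contains no extremum, and deleting it (gluing the two
strips) gives a height function with one row less and as many extrema.  A height
function with no such row is called row-reduced; the same can be done with
columns.

The point is that reduced height functions with [d] extrema live on grids of
bounded size.  A unit square around which the heights alternate, [t, t + 1, t,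
t + 1], is a saddle; the vertical step of a strip changes along the strip exactly
at the saddles.  Summation by parts of the product of the second differences in
the two directions (an index formula) gives [saddles_le_extrema]: there are at
most [d] saddles.  A row that cannot be deleted is next to a strip containing a
saddle, or is a valley or a ridge between two flat strips with opposite steps; in
the latter case the minimum or maximum of the heights on that row is an extremum.
Each saddle is charged for at most two rows and each extremum for at most one, so
a row-reduced height function has at most [3 d + 2] rows ([row_reduced_bound]).

Conversely, all height functions with a given reduction arise by repeating flat
strips.  Read as a word whose letters are its strips, a height function reduces
to a fixed word [u] in a number of ways that depends only on the length [l] of
the word and on the list of booleans telling which letters of [u] are flat
([card_collapse]).  This number, [expansions], satisfies a Pascal-like recurrence
in [l], so it agrees with an integer-valued polynomial in [l] as soon as [l]
exceeds the length of [u] ([expansions_polynomial]).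

Reducing the rows, transposing, and reducing again writes [E d (a + 1) (b + 1)]
as a fixed finite sum of terms [K * expansions a phi * expansions b psi]
([nb_fields_with_extrema]).  Each factor is one polynomial in the size for large
sizes, and there are finitely many smaller sizes; cutting each half-line at
finitely many integers gives the regions of the theorem. *)

(** * Height fields and the index formula *)

(** Heights are total functions on pairs of naturals, of which only the values on
the grid [0..a] x [0..b] matter: [a] and [b] are the numbers of strips, one less
than the numbers of rows and columns. *)
Definition height (a b : nat) (h : nat -> nat -> int) : Prop :=
  [/\ h 0%N 0%N = 0,
      forall i j, (i < a)%N -> (j <= b)%N -> `|h i.+1 j - h i j| = 1 &
      forall i j, (i <= a)%N -> (j < b)%N -> `|h i j.+1 - h i j| = 1].

(** [s = 1] is a strict local minimum and [s = -1] a strict local maximum; for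
[i = 0] and [j = 0] the predecessors are guarded, as [0.-1 = 0]. *)
Definition apex (a b : nat) (h : nat -> nat -> int) (s : int) (i j : nat) :=
  [&& (0 < i)%N ==> (h i.-1 j == h i j + s), (i < a)%N ==> (h i.+1 j == h i j + s),
      (0 < j)%N ==> (h i j.-1 == h i j + s) & (j < b)%N ==> (h i j.+1 == h i j + s)].

Definition extremal a b h i j := apex a b h 1 i j || apex a b h (-1) i j.

Definition nb_extrema a b h : nat :=
  (\sum_(i < a.+1) \sum_(j < b.+1) extremal a b h i j)%N.

Definition transpose (h : nat -> nat -> int) i j := h j i.

Lemma height_transpose a b h : height a b h -> height b a (transpose h).
Proof. by case=> h0 hv hh; split=> // i j ia jb; rewrite /transpose ?hh ?hv. Qed.

Lemma nb_extrema_transpose a b h : nb_extrema b a (transpose h) = nb_extrema a b h.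
Proof.
rewrite /nb_extrema exchange_big; apply: eq_bigr => i _; apply: eq_bigr => j _.
have swap p q r s : [&& p, q, r & s] = [&& r, s, p & q] by case: p q r s => [] [] [] [].
by rewrite /extremal /apex /transpose [X in X || _]swap [X in _ || X]swap.
Qed.

(** The two vertical steps of a unit square of a height function differ exactly
when the heights alternate around it. *)
Definition saddle (h : nat -> nat -> int) i j := h i.+1 j - h i j != h i.+1 j.+1 - h i j.+1.

(** The difference of two consecutive steps, where the steps that leave the grid
count as zero; this choice makes the summation by parts free of boundary terms. *)
Definition turn (a : nat) (f : nat -> int) (i : nat) : int :=
  (if (i < a)%N then f i else 0) - (if (0 < i)%N then f i.-1 else 0).

Definition vstep (h : nat -> nat -> int) j i := h i.+1 j - h i j.
Definition hstep (h : nat -> nat -> int) i j := h i j.+1 - h i j.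

Lemma sum_turn a (f g : nat -> int) :
  \sum_(i < a.+1) turn a f i * g i = \sum_(i < a) f i * (g i - g i.+1).
Proof.
under eq_bigr do rewrite mulrBl; under [RHS]eq_bigr do rewrite mulrBr.
rewrite !sumrB big_ord_recr [X in _ - X]big_ord_recl /= ltnn !mul0r addr0 add0r.
by congr (_ - _); apply: eq_bigr => i _; rewrite ltn_ord.
Qed.

Lemma turnB a f g i : turn a f i - turn a g i = turn a (fun k => f k - g k) i.
Proof. by rewrite /turn; case: ifP; case: ifP => _ _; ring. Qed.

(** The index formula: both sides come from the same sum over the corners of the
unit squares.  Summing by parts in both directions gives the product of the
difference of the vertical steps of a square with that of its horizontal steps,
and these two differences coincide. *)
Lemma sum_turn_turn a b h :
  \sum_(i < a.+1) \sum_(j < b.+1) turn a (vstep h j) i * turn b (hstep h i) j =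
  \sum_(i < a) \sum_(j < b) (vstep h j i - vstep h j.+1 i) ^+ 2.
Proof.
rewrite exchange_big; under eq_bigr => j _.
  rewrite (sum_turn _ _ (fun i => turn b (hstep h i) j)).
  under eq_bigr => i _ do rewrite turnB mulrC.
  over.
rewrite exchange_big; apply: eq_bigr => i _; rewrite (sum_turn _ _ (fun j => vstep h j i)).
by apply: eq_bigr => j _; rewrite /vstep /hstep; ring.
Qed.

Lemma unit_step (x y : int) : `|x - y| = 1 -> {e : bool | x = y + (-1) ^+ e}.
Proof. by move=> xy; exists (x < y); case: ltP; rewrite /= ?expr0 ?expr1; lia. Qed.

(** The turn in one direction is positive only at a valley in that direction and
negative only at a ridge, so the product of the two turns is positive only at an
extremum; moreover each turn is at most 2 in absolute value. *)
Lemma turn_le_extremal a b h i j : height a b h -> (i <= a)%N -> (j <= b)%N ->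
  turn a (vstep h j) i * turn b (hstep h i) j <= 4 * (extremal a b h i j)%:Z.
Proof.
case=> _ hv hh ia jb; rewrite /turn /extremal /apex /vstep /hstep.
have up : (0 < i)%N -> {e : bool | h i.-1 j = h i j + (-1) ^+ e}.
  by move=> i0; apply: unit_step; rewrite distrC -{1}(prednK i0) hv // prednK.
have left : (0 < j)%N -> {e : bool | h i j.-1 = h i j + (-1) ^+ e}.
  by move=> j0; apply: unit_step; rewrite distrC -{1}(prednK j0) hh // prednK.
have down : (i < a)%N -> {e : bool | h i.+1 j = h i j + (-1) ^+ e}.
  by move=> ?; apply/unit_step/hv.
have right : (j < b)%N -> {e : bool | h i j.+1 = h i j + (-1) ^+ e}.
  by move=> ?; apply/unit_step/hh.
have step1 (e : bool) : (h i j + (-1) ^+ e == h i j + 1) = ~~ e.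
  by rewrite (inj_eq (addrI _)); case: e.
have stepN1 (e : bool) : (h i j + (-1) ^+ e == h i j + -1) = e.
  by rewrite (inj_eq (addrI _)); case: e.
have stepK (e : bool) : h i j + (-1) ^+ e - h i j = (-1) ^+ e :> int by rewrite addrC addKr.
have stepK' (e : bool) : h i j - (h i j + (-1) ^+ e) = - (-1) ^+ e :> int.
  by rewrite opprD addNKr.
case: (ltnP i a) down => [_ /(_ isT) [e1 ->]|_ _];
(case: (ltnP 0%N i) up => [i0 /(_ isT) [e2 E2]|_ _]; [rewrite (prednK i0) E2|]);
case: (ltnP j b) right => [_ /(_ isT) [e3 ->]|_ _];
(case: (ltnP 0%N j) left => [j0 /(_ isT) [e4 E4]|_ _]; [rewrite (prednK j0) E4|]);
rewrite ?step1 ?stepN1 ?stepK ?stepK' ?implybT /= {hv hh step1 stepN1 stepK stepK'}.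
all: try clear E2; try clear E4.
all: try case: e1; try case: e2; try case: e3; try case: e4; rewrite ?expr0 ?expr1 //=.
Qed.

(** A saddle contributes 4 to the right-hand side of the index formula, and a
cell contributes to the left-hand side at most 4, and that only at an extremum. *)
Lemma saddles_le_extrema a b h : height a b h ->
  (\sum_(i < a) \sum_(j < b) saddle h i j <= nb_extrema a b h)%N.
Proof.
move=> hP; have [_ hv _] := hP; rewrite -lez_nat -(@ler_pM2l _ 4) //.
have sumZ (p q : nat) (F : nat -> nat -> bool) :
    4 * (\sum_(i < p) \sum_(j < q) F i j)%N%:Z = \sum_(i < p) \sum_(j < q) 4 * (F i j)%:Z :> int.
  rewrite (big_morph Posz PoszD (erefl _)) mulr_sumr; apply: eq_bigr => i _.
  by rewrite (big_morph Posz PoszD (erefl _)) mulr_sumr.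
rewrite /nb_extrema !sumZ.
have -> : \sum_(i < a) \sum_(j < b) 4 * (saddle h i j)%:Z =
    \sum_(i < a) \sum_(j < b) (vstep h j i - vstep h j.+1 i) ^+ 2.
  apply: eq_bigr => i _; apply: eq_bigr => j _; rewrite /saddle /vstep.
  have := hv i j (ltn_ord i) (ltnW (ltn_ord j)); have := hv i j.+1 (ltn_ord i) (ltn_ord j).
  move: (h i.+1 j - h i j) (h i.+1 j.+1 - h i j.+1) => x y x1 y1.
  have [-> | ->] : x = 1 \/ x = -1 by lia.
    by have [-> | ->] : y = 1 \/ y = -1 by lia.
  by have [-> | ->] : y = 1 \/ y = -1 by lia.
rewrite -sum_turn_turn; apply: ler_sum => i _; apply: ler_sum => j _.
by apply: turn_le_extremal => //; rewrite -ltnS.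
Qed.

(** * Row-reduced height fields have boundedly many rows *)

Definition flat b h i := [forall j : 'I_b.+1, vstep h j i == vstep h 0%N i].

Lemma flatP b h i : reflect (forall j, (j <= b)%N -> vstep h j i = vstep h 0%N i) (flat b h i).
Proof.
apply: (iffP forallP) => [H j jb|H j]; last by rewrite H // -ltnS.
by apply/eqP/(H (Ordinal (jb : (j < b.+1)%N))).
Qed.

Lemma flatN_saddle b h i : ~~ flat b h i -> (0 < \sum_(j < b) saddle h i j)%N.
Proof.
apply: contraNT; rewrite -leqNgt leqn0 sum_nat_eq0 => /forallP H.
apply/flatP; elim=> // j IH jb.
by rewrite -IH ?(ltnW jb) //; have := H (Ordinal jb); rewrite eqb0 negbK => /eqP.
Qed.

Definition row_reduced a b h := forall i, (i.+1 < a)%N ->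
  ~ [/\ flat b h i, flat b h i.+1 & vstep h 0%N i = vstep h 0%N i.+1].

(** Every cell of such a row is a minimum (or every cell is a maximum) for the
vertical neighbours, so the lowest (or highest) cell of the row is an extremum. *)
Lemma flat_turn_extremum a b h i : height a b h -> (i.+1 < a)%N ->
  flat b h i -> flat b h i.+1 -> vstep h 0%N i <> vstep h 0%N i.+1 ->
  (0 < \sum_(j < b.+1) extremal a b h i.+1 j)%N.
Proof.
move=> [_ hv hh] ia /flatP Fi /flatP Fi1 neq.
pose s := vstep h 0%N i.+1.
have s1 : s = 1 \/ s = -1 by have := hv i.+1 0%N ia isT; rewrite /s /vstep; lia.
have s0 : vstep h 0%N i = - s.
  by have := hv i 0%N (ltnW ia) isT; move: neq s1; rewrite /s /vstep; lia.
(* [s = 1] for a valley and [s = -1] for a ridge, so that minimizing [s * h]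
   picks the required cell in both cases. *)
have [j _ jmin] := arg_minP (fun j : 'I_b.+1 => s * h i.+1 j) (isT : predT (ord0 : 'I_b.+1)).
rewrite lt0n sum_nat_eq0; apply/forallPn; exists j; rewrite eqb0 negbK.
suff A : apex a b h s i.+1 j by case: s1 A => -> A; rewrite /extremal A ?orbT.
have jb : (j <= b)%N by rewrite -ltnS.
apply/and4P; split; apply/implyP => H.
- by have := Fi j jb; rewrite s0 {1}/vstep /=; clearbody s; lia.
- by have := Fi1 j jb; rewrite -/s {1}/vstep; clearbody s; lia.
- have j1 : (j.-1 < b.+1)%N by lia.
  have /= := jmin (Ordinal j1) isT; have := hh i.+1 j.-1 (ltnW ia); rewrite prednK // => /(_ jb).
  by case: s1 => ->; lia.
- have /= := jmin (Ordinal (H : (j.+1 < b.+1)%N)) isT; have := hh i.+1 j (ltnW ia) H.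
  by case: s1 => ->; lia.
Qed.

(** Each inner row of a row-reduced field is charged to a saddle of one of its two
strips or to an extremum on it. *)
Lemma row_reduced_bound a b h : height a b h -> row_reduced a b h ->
  (a <= (3 * nb_extrema a b h).+1)%N.
Proof.
move=> hP red; have sad_le := saddles_le_extrema hP.
pose sad i := (\sum_(j < b) saddle h i j)%N.
pose ext i := (\sum_(j < b.+1) extremal a b h i j)%N.
case: a hP red sad_le @ext => // a hP red sad_le ext.
have row (i : 'I_a) : (1 <= sad i + sad i.+1 + ext i.+1)%N.
  have [Fi|/flatN_saddle] := boolP (flat b h i); last by rewrite -/(sad i); lia.
  have [Fi1|/flatN_saddle] := boolP (flat b h i.+1); last by rewrite -/(sad i.+1); lia.
  have ia : (i.+1 < a.+1)%N by rewrite ltnS.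
  suff : (0 < ext i.+1)%N by lia.
  by apply: flat_turn_extremum => // st; apply: (red i).
have : (\sum_(i < a) 1 <= \sum_(i < a) (sad i + sad i.+1 + ext i.+1))%N by apply: leq_sum.
rewrite sum1_card card_ord !big_split /=.
have : (\sum_(i < a) sad i <= nb_extrema a.+1 b h)%N.
  by apply: leq_trans sad_le; rewrite big_ord_recr /= leq_addr.
have : (\sum_(i < a) sad i.+1 <= nb_extrema a.+1 b h)%N.
  by apply: leq_trans sad_le; rewrite big_ord_recl /= leq_addl.
have : (\sum_(i < a) ext i.+1 <= nb_extrema a.+1 b h)%N.
  rewrite /nb_extrema big_ord_recl; apply: leq_trans (leq_addl _ _).
  by rewrite big_ord_recr leq_addr.
move=> le3 le2 le1 le; rewrite ltnS.
apply: leq_trans le (leq_trans (leq_add (leq_add le1 le2) le3) _).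
by rewrite mulSn mulSn mul1n addnA.
Qed.

(** * Repeating a flat strip *)

(** [h'] arises from [h] by repeating strip [k], which is flat with step [c]: the
rows from [k + 1] on move down by one and shift by [c], while the old row [k + 1]
also stays in place as the middle row of the doubled strip. *)
Definition row_dup (k : nat) (a b : nat) (h h' : nat -> nat -> int) :=
  exists c : int, [/\ (k < a)%N, forall j, (j <= b)%N -> h k.+1 j = h k j + c,
    forall i j, (i <= k.+1)%N -> (j <= b)%N -> h' i j = h i j &
    forall i j, (k < i)%N -> (i <= a)%N -> (j <= b)%N -> h' i.+1 j = h i j + c].

Lemma addrBK2 (x y z : int) : (x + z) - (y + z) = x - y.
Proof. by rewrite opprD addrACA subrr addr0. Qed.

Lemma row_dup_height k a b h h' : row_dup k a b h h' ->
  height a b h <-> height a.+1 b h'.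
Proof.
case=> c [ka hk lo hi]; split=> - [h0 hv hh]; split.
- by rewrite lo.
- move=> i j ia jb; have [ik|ki] := leqP i k.
    by rewrite !lo ?hv ?(leqW ik) //; apply: leq_ltn_trans ka.
  have [->|ik] := eqVneq i k.+1; last first.
    case: i ia ki ik => // i ia ki ik; have ki' : (k < i)%N by lia.
    rewrite ltnS in ia.
    by rewrite (hi i.+1) // (hi i) ?(ltnW ia) // addrBK2 hv.
  by rewrite hi // lo // addrC addKr; have := hv k j ka jb; rewrite hk // addrC addKr.
- move=> i j ia jb; have [ik|ki] := leqP i k.+1.
    by rewrite !lo ?hh ?(ltnW jb) //; apply: leq_trans ka.
  case: i ia ki => // i ia ki.
  by rewrite !(hi i) ?(ltnW jb) // addrBK2 hh.
- by rewrite -lo.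
- move=> i j ia jb; have [ik|ki] := leqP i k.
    by rewrite -!lo ?hv ?(leqW ik) //; apply: leqW.
  have := hv i.+1 j ia jb.
  by rewrite (hi i.+1) ?(ltnW ki) ?(leqW ki) // (hi i) ?(ltnW ia) // addrBK2.
- move=> i j ia jb; have [ik|ki] := leqP i k.+1.
    by rewrite -!lo ?hh ?(ltnW jb) //; apply: leqW.
  have := hh i.+1 j ia jb; rewrite !(hi i) ?(ltnW jb) ?(ltnW ki) //.
  by rewrite addrBK2.
Qed.

(** [bump k.+1] skips the inserted row [k + 1]. *)
Lemma row_dup_apex k a b h h' s i j : row_dup k a b h h' -> (i <= a)%N -> (j <= b)%N ->
  apex a.+1 b h' s (bump k.+1 i) j = apex a b h s i j.
Proof.
case=> c [ka hk lo hi] ia jb; rewrite /apex /bump.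
have cancel (x y z : int) : (x + z == y + z + s) = (x == y + s).
  by rewrite addrAC (inj_eq (addIr _)).
have hor (d : int) (F : nat -> int) : (forall j', (j' <= b)%N -> F j' = h i j' + d) ->
    (0 < j)%N ==> (F j.-1 == F j + s) = (0 < j)%N ==> (h i j.-1 == h i j + s) /\
    (j < b)%N ==> (F j.+1 == F j + s) = (j < b)%N ==> (h i j.+1 == h i j + s).
  move=> FE; split; case: (boolP (_ < _)%N) => //= jj; rewrite !FE ?cancel //.
  by lia.
have [ki|ik] := ltnP k i; rewrite ?add1n ?add0n /=.
  have [-> ->] := hor c (h' i.+1) (fun j' => hi i j' ki ia).
  rewrite (hi i) // (leq_trans _ ki) //= ltnS; congr [&& _, _ & _].
    have [->|ik] := eqVneq i k.+1; first by rewrite lo // hk // cancel.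
    case: i ia ki ik {hor} => // i ia ki ik; have ki' : (k < i)%N by lia.
    by rewrite hi ?cancel // ltnW.
  by case: (ltnP i a) => //= ia'; rewrite hi ?cancel // ltnW.
have ik1 : (i <= k.+1)%N by apply: leq_trans ik _.
have [|-> ->] := hor 0 (h' i); first by move=> j' jb'; rewrite lo // addr0.
rewrite !(lo i) //; congr [&& _, _ & _].
  by case: (ltnP 0 i) => //= i0; rewrite lo //; lia.
by rewrite ltnS ia (leq_ltn_trans ik ka) lo //.
Qed.

(** The heights are monotone down each column across the inserted row. *)
Lemma row_dup_new_row k a b h h' j : row_dup k a b h h' -> height a b h -> (j <= b)%N ->
  extremal a.+1 b h' k.+1 j = false.
Proof.
case=> c [ka hk lo hi] [_ hv _] jb; have := hv k j ka jb; rewrite hk // addrC addKr => c1.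
rewrite /extremal /apex /= ltnS ka lo // lo // hi // hk //=.
by case: eqP; case: eqP; case: eqP; case: eqP; rewrite ?andbF //; lia.
Qed.

Lemma row_dup_nb_extrema k a b h h' : row_dup k a b h h' -> height a b h ->
  nb_extrema a.+1 b h' = nb_extrema a b h.
Proof.
move=> dup hP; have ka : (k.+1 < a.+2)%N by case: dup => c [ka _ _ _]; rewrite ltnS ltnW.
rewrite /nb_extrema (bigD1_ord (Ordinal ka)) //= big1 ?add0n; last first.
  by move=> j _; rewrite (row_dup_new_row dup) // -ltnS.
apply: eq_bigr => i _; apply: eq_bigr => j _.
by rewrite /extremal !(row_dup_apex _ dup) // -ltnS.
Qed.

(** Repeating a horizontal strip affects neither which vertical strips are flat
nor their steps, so that rows and columns can be reduced independently. *)
Lemma row_dup_top k a b h h' j : row_dup k a b h h' -> (j < b)%N ->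
  vstep (transpose h') 0%N j = vstep (transpose h) 0%N j.
Proof. by case=> c [ka hk lo hi] jb; rewrite /vstep /transpose !lo // ltnW. Qed.

Lemma row_dup_flat k a b h h' j : row_dup k a b h h' -> (j < b)%N ->
  flat a.+1 (transpose h') j = flat a (transpose h) j.
Proof.
move=> dup jb; have top := row_dup_top dup jb; case: dup => c [ka hk lo hi].
apply/flatP/flatP => F i ia; last first.
  rewrite top; have [ik|ki] := leqP i k.+1.
    by rewrite /vstep /transpose !lo ?(ltnW jb) //; apply: F; lia.
  case: i ia ki => // i ia ki; rewrite /vstep /transpose !hi ?(ltnW jb) //.
  by rewrite addrBK2; apply: F.
rewrite -top; have [ik|ki] := leqP i k.+1.
  by have := F i (leqW ia); rewrite /vstep /transpose !lo // ltnW.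
have := F i.+1 ia; rewrite {1}/vstep /transpose !hi ?(ltnW jb) ?(ltnW ki) //.
by rewrite addrBK2.
Qed.

(** * Words with repeatable letters *)

(** The number of words of length [l] that reduce to a given reduced word whose
letters are repeatable or not according to [phi]: the first letter of the word is
the first letter of the reduced word, and the rest reduces to the tail or, if that
letter is repeatable, again to the whole reduced word. *)
Fixpoint expansions (l : nat) (phi : seq bool) : nat :=
  match l, phi with
  | 0, [::] => 1
  | l'.+1, f :: phi' => expansions l' phi' + (if f then expansions l' phi else 0)
  | _, _ => 0
  end.

Lemma sum_tuple_cons (T : finType) l (F : seq T -> nat) :
  (\sum_(w : l.+1.-tuple T) F w = \sum_(x : T) \sum_(w : l.-tuple T) F (x :: w))%N.
Proof.
rewrite pair_big /= (reindex (fun p : T * l.-tuple T => [tuple of p.1 :: p.2])) //=.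
exists (fun w : l.+1.-tuple T => (thead w, [tuple of behead w])) => [[x w] _|w _].
  by congr pair; apply: val_inj.
by rewrite -tuple_eta.
Qed.

Section Collapse.
Variables (T : eqType) (free : pred T).

(** Merging from the right is enough: a letter is compared with the first letter
of the part that is already reduced. *)
Fixpoint collapse (w : seq T) : seq T :=
  if w is x :: w' then
    let r := collapse w' in if free x && (ohead r == Some x) then r else x :: r
  else [::].

Definition reduced (w : seq T) := sorted (fun x y => ~~ (free x && (x == y))) w.

Lemma collapse_reduced w : reduced (collapse w).
Proof.
elim: w => // x w IH /=; case: ifP => // /negbT nx.
move: nx IH; rewrite /reduced; case: (collapse w) => // y r /= nx ->.
by rewrite andbT; apply: contra nx => /andP[-> /eqP ->]; rewrite eqxx.
Qed.

(** This is the recurrence of [expansions]. *)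
Lemma collapse_cons x w a u : reduced (a :: u) ->
  (collapse (x :: w) == a :: u) =
  (x == a) && ((collapse w == u) || free a && (collapse w == a :: u)).
Proof.
have := collapse_reduced w; rewrite /reduced /=; move: (collapse w) => r.
case: r => [|y r] /= pr pu.
  by rewrite andbF /= eqseq_cons andbF orbF.
have [->|yx] := eqVneq y x; last first.
  rewrite (_ : Some y == Some x = false) ?andbF; last by apply: contraNF yx => /eqP[->].
  rewrite !eqseq_cons; case: (eqVneq x a) => //= xa; rewrite -xa (negbTE yx) andbF orbF //.
rewrite eqxx andbT; case fx: (free x); rewrite !eqseq_cons; case: (eqVneq x a) => //= xa.
  rewrite -xa fx /=; rewrite orbC; case: (eqVneq r u) => //= _.
  apply/esym/negbTE; apply: contraTN pu => /eqP <- /=.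
  by rewrite -xa fx eqxx.
by rewrite -xa fx orbF.
Qed.

Lemma collapse_invariant (L : seq T -> Prop) :
  (forall w1 w2 x, free x -> L (w1 ++ [:: x, x & w2]) <-> L (w1 ++ x :: w2)) ->
  forall w, L (collapse w) <-> L w.
Proof.
move=> dupL w; rewrite -[collapse w]cat0s -[w in X in _ <-> X]cat0s.
elim: w [::] => // x w IH p /=; rewrite -cat_rcons -IH cat_rcons.
case: ifP => // /andP[fx]; case: (collapse w) => // y r /= /eqP[->].
by rewrite dupL.
Qed.

End Collapse.

Lemma card_collapse (T : finType) (free : pred T) l (u : seq T) : reduced free u ->
  (\sum_(w : l.-tuple T) (collapse free w == u) = expansions l (map free u))%N.
Proof.
elim: l u => [|l IH] u ured.
  rewrite (big_pred1 [tuple]) => [|w]; last by rewrite (tuple0 w) [RHS]/= eqxx.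
  by case: u {ured}.
rewrite (sum_tuple_cons _ (fun w => nat_of_bool (collapse free w == u))).
case: u ured => [|a u] ured.
  rewrite big1 // => x _; rewrite big1 // => w _ /=.
  by case: (collapse free w) => [|y r]; [rewrite /= andbF|case: (_ && _)].
under eq_bigr => x _ do under eq_bigr => w _ do rewrite collapse_cons //.
rewrite (bigD1 a) //= [X in (_ + X)%N]big1 ?addn0 => [|x xa]; last first.
  by rewrite big1 // => w _; rewrite (negbTE xa).
rewrite eqxx -IH; last by move: ured; rewrite /reduced /= => /path_sorted.
case fa: (free a); last by rewrite addn0; apply: eq_bigr => w _; rewrite orbF.
have -> : true :: map free u = map free (a :: u) by rewrite /= fa.
rewrite -IH // -big_split /=.
apply: eq_bigr => w _; case: eqP => //= ->.
by rewrite (_ : (u == a :: u) = false) //; apply/eqP => /(congr1 size) /=; lia.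
Qed.

(** The words of a class that is stable under repeating and merging repeatable
letters are classified by the word they reduce to. *)
Lemma card_words (T : finType) (free : pred T) (L : pred (seq T)) (B l : nat) :
  (forall w1 w2 x, free x -> L (w1 ++ [:: x, x & w2]) = L (w1 ++ x :: w2)) ->
  (forall w, L w -> reduced free w -> (size w <= B)%N) ->
  (\sum_(w : l.-tuple T) L w =
   \sum_(k < B.+1) \sum_(u : k.-tuple T | L u && reduced free u) expansions l (map free u))%N.
Proof.
move=> dupL redB.
under [RHS]eq_bigr => k _ do under eq_bigr => u /andP[_ ured] do rewrite -card_collapse //.
under [RHS]eq_bigr => k _ do rewrite exchange_big.
rewrite [RHS]exchange_big; apply: eq_bigr => w _ /=.
have cL : L (collapse free w) = L w.
  by apply/idP/idP; apply collapse_invariant => // *; rewrite dupL.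
have cred := collapse_reduced free w.
rewrite -cL; have [Lc|nLc] := boolP (L (collapse free w)); last first.
  rewrite big1 // => k _; rewrite big1 // => u /andP[Lu _].
  by case: eqP => // cu; rewrite cu Lu in nLc.
have cB : (size (collapse free w) < B.+1)%N by rewrite ltnS redB.
rewrite (bigD1 (Ordinal cB)) //= [X in (_ + X)%N]big1 ?addn0 => [|k /negP nk]; last first.
  rewrite big1 // => u _; case: eqP => // cu; case: nk.
  by apply/eqP/val_inj; rewrite /= cu size_tuple.
rewrite (bigD1 (in_tuple (collapse free w))) /= ?Lc ?cred ?eqxx // big1 // => u /andP[_ nu].
by case: eqP => // cu; case/eqP: nu; apply: val_inj.
Qed.

(** * Coding height fields by words of strips *)

Definition sg (e : bool) : int := if e then 1 else -1.

Lemma sg_inj : injective sg.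
Proof. by case=> [] []. Qed.

Lemma sgK e : (sg e == 1) = e.
Proof. by case: e. Qed.

Lemma unitK (x : int) : `|x| = 1 -> sg (x == 1) = x.
Proof. by move=> x1; have [->|->] : x = 1 \/ x = -1 by lia. Qed.

(** [y] lists the steps along the top row and the letters of [w] the vertical steps
of the successive strips.  Heights outside the grid are set to zero, which makes
the coding injective up to equality of functions. *)
Definition decode (b : nat) (y : seq bool) (w : seq (b.+1.-tuple bool)) (i j : nat) : int :=
  if (i <= size w)%N && (j <= b)%N then
    \sum_(e <- take j y) sg e + \sum_(x <- take i w) sg (nth false x j)
  else 0.

Definition blank b : b.+1.-tuple bool := [tuple false | _ < b.+1].

Lemma vstep_decode b y (w : seq (b.+1.-tuple bool)) i j : (i < size w)%N -> (j <= b)%N ->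
  vstep (decode y w) j i = sg (nth false (nth (blank b) w i) j).
Proof.
move=> iw jb; rewrite /vstep /decode iw (ltnW iw) jb /=.
rewrite (take_nth (blank b)) // -cats1 big_cat big_seq1 /=.
by rewrite opprD addrACA subrr add0r addrC addKr.
Qed.

Lemma top_decode b y (w : seq (b.+1.-tuple bool)) j : size y = b -> (j < b)%N ->
  vstep (transpose (decode y w)) 0%N j = sg (nth false y j).
Proof.
move=> yb jb; rewrite /vstep /transpose /decode /= jb (ltnW jb) !take0 !big_nil !addr0.
by rewrite (take_nth false) ?yb // -cats1 big_cat big_seq1 addrC addKr.
Qed.

Definition encode (a b : nat) (h : nat -> nat -> int) :
    b.-tuple bool * a.-tuple (b.+1.-tuple bool) :=
  ([tuple vstep (transpose h) 0%N j == 1 | j < b],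
   [tuple [tuple vstep h j i == 1 | j < b.+1] | i < a]).

Lemma decodeK a b (y : b.-tuple bool) (w : a.-tuple (b.+1.-tuple bool)) :
  encode a b (decode y w) = (y, w).
Proof.
congr pair; apply: eq_from_tnth => i; rewrite tnth_mktuple.
  by rewrite top_decode ?size_tuple // sgK (tnth_nth false).
apply: eq_from_tnth => j; rewrite tnth_mktuple vstep_decode ?size_tuple //; last by rewrite -ltnS.
by rewrite sgK (tnth_nth (blank b)) (tnth_nth false).
Qed.

Definition supported a b (h : nat -> nat -> int) :=
  forall i j, ~~ ((i <= a)%N && (j <= b)%N) -> h i j = 0.

Lemma supported_decode a b y (w : a.-tuple (b.+1.-tuple bool)) : supported a b (decode y w).
Proof. by move=> i j; rewrite /decode size_tuple => /negbTE ->. Qed.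

Lemma encodeK a b h : height a b h -> supported a b h ->
  decode (encode a b h).1 (encode a b h).2 = h.
Proof.
move=> [h0 hv hh] supp; set g := decode _ _.
have gsupp : supported a b g by apply: supported_decode.
have gv i j : (i < a)%N -> (j <= b)%N -> vstep g j i = vstep h j i.
  move=> ia jb; rewrite vstep_decode ?size_tuple //.
  rewrite -[i]/(val (Ordinal ia)) -tnth_nth tnth_mktuple.
  by rewrite -[j]/(val (Ordinal (jb : (j < b.+1)%N))) -tnth_nth tnth_mktuple unitK ?hv.
have g0 j : (j <= b)%N -> g 0%N j = h 0%N j.
  elim: j => [_|j IH jb]; first by rewrite h0 /g /decode /= !take0 !big_nil addr0.
  have : vstep (transpose g) 0%N j = vstep (transpose h) 0%N j.
    rewrite top_decode ?size_tuple // -[j]/(val (Ordinal jb)) -tnth_nth tnth_mktuple.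
    by rewrite unitK ?hh.
  by rewrite /vstep /transpose (IH (ltnW jb)) => /addIr.
apply/funext => i; apply/funext => j.
have [/andP[ia jb]|nij] := boolP ((i <= a) && (j <= b))%N; last by rewrite gsupp ?supp.
elim: i ia => [|i IH] ia; first exact: g0.
by have := gv i j ia jb; rewrite /vstep (IH (ltnW ia)) => /addIr.
Qed.

(** The letters of flat strips, see [flat_decode]. *)
Definition level (b : nat) (x : b.+1.-tuple bool) : bool :=
  [forall j : 'I_b.+1, tnth x j == tnth x ord0].

Lemma levelP b (x : b.+1.-tuple bool) :
  reflect (forall j, (j <= b)%N -> nth false x j = nth false x 0) (level x).
Proof.
apply: (iffP forallP) => [H j jb|H j].
  by have /eqP := H (Ordinal (jb : (j < b.+1)%N)); rewrite !(tnth_nth false).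
by rewrite !(tnth_nth false) H // -ltnS.
Qed.

Lemma flat_decode b y (w : seq (b.+1.-tuple bool)) i : (i < size w)%N ->
  flat b (decode y w) i = level (nth (blank b) w i).
Proof.
move=> iw; apply/flatP/levelP => H j jb; last by rewrite !vstep_decode ?H.
by apply: sg_inj; rewrite -!(vstep_decode y) ?H.
Qed.

Lemma row_dup_decode b y (w1 w2 : seq (b.+1.-tuple bool)) x : level x ->
  row_dup (size w1) (size (w1 ++ x :: w2)) b
    (decode y (w1 ++ x :: w2)) (decode y (w1 ++ [:: x, x & w2])).
Proof.
move=> /levelP lx; exists (sg (nth false x 0)).
split; first by rewrite size_cat /= addnS leq_addr.
- move=> j jb; have sw : (size w1 < size (w1 ++ x :: w2))%N.
    by rewrite size_cat /= addnS ltnS leq_addr.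
  apply/eqP; rewrite addrC -subr_eq; apply/eqP.
  by rewrite [LHS](vstep_decode y sw jb) nth_cat ltnn subnn /= lx.
- move=> i j iw jb; rewrite /decode !size_cat /= jb !andbT.
  rewrite !addnS (leq_trans iw) ?(leq_trans iw) ?ltnS ?leqW ?leq_addr //.
  congr (_ + _); apply: congr_big => //; rewrite !take_cat; case: ltnP => // wi.
  have : (i - size w1 <= 1)%N by rewrite leq_subLR addn1.
  by case: (i - size w1)%N => [|[|?]] //= _; rewrite ?take0.
- move=> i j wi iw jb; rewrite /decode !size_cat /= jb !andbT.
  move: (iw); rewrite size_cat /= => iw'; rewrite iw' addnS ltnS iw'.
  rewrite -addrA; congr (_ + _); rewrite !take_cat !ltnNge (ltnW wi) (leqW (ltnW wi)) /=.
  have -> : (i.+1 - size w1 = (i - size w1).-1.+2)%N by lia.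
  have -> : (i - size w1 = (i - size w1).-1.+1)%N by lia.
  rewrite !big_cat /= !big_cons lx // addrA.
  by rewrite [RHS]addrAC -!addrA; congr (_ + _); rewrite addrA addrC addrA.
Qed.

Lemma eq_level b (x z : b.+1.-tuple bool) : level x -> level z ->
  (x == z) = (nth false x 0 == nth false z 0).
Proof.
move=> /levelP lx /levelP lz; apply/eqP/eqP => [-> //|xz].
by apply: eq_from_tnth => j; rewrite !(tnth_nth false) lx ?lz // -ltnS.
Qed.

Lemma row_reduced_decode b y (w : seq (b.+1.-tuple bool)) :
  row_reduced (size w) b (decode y w) <-> reduced (@level b) w.
Proof.
have eq i : (i.+1 < size w)%N ->
  [/\ flat b (decode y w) i, flat b (decode y w) i.+1 &
      vstep (decode y w) 0%N i = vstep (decode y w) 0%N i.+1] <->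
  level (nth (blank b) w i) && (nth (blank b) w i == nth (blank b) w i.+1).
  move=> iw; rewrite !flat_decode ?(ltnW iw) // !vstep_decode ?(ltnW iw) //; split.
    by move=> [l1 l2 /sg_inj e]; rewrite l1 eq_level // e eqxx.
  by move=> /andP[l1 /eqP <-].
split=> [H|/(sortedP (blank b)) H i iw B].
  by apply/(sortedP (blank b)) => i iw; apply/negP => B; apply: (H i iw); apply/(eq i iw).
by have := H i iw; rewrite (iffLR (eq i iw) B).
Qed.

(** * Counting by reduction of rows and columns *)

(** The words that code no height function are discarded by [Q], which will always
imply [height]. *)
Definition nb_fields a b (Q : (nat -> nat -> int) -> Prop) : nat :=
  (\sum_(y : b.-tuple bool) \sum_(w : a.-tuple (b.+1.-tuple bool)) `[< Q (decode y w) >])%N.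

Lemma nb_fieldsE a b Q : nb_fields a b Q =
  #|[set c : b.-tuple bool * a.-tuple (b.+1.-tuple bool) | `[< Q (decode c.1 c.2) >]]|.
Proof.
rewrite /nb_fields pair_big -sum1_card /= [RHS]big_mkcond /=; apply: eq_bigr => c _.
by rewrite inE; case: ifP => // ->.
Qed.

Lemma eq_nb_fields a b Q Q' : (forall h, Q h <-> Q' h) -> nb_fields a b Q = nb_fields a b Q'.
Proof.
move=> QQ; apply: eq_bigr => y _; apply: eq_bigr => w _; congr (nat_of_bool _).
exact/asbool_equiv_eq.
Qed.

(** Decoding, transposing and encoding again is injective. The converse inequality
is the same statement for the transposed property. *)
Lemma leq_nb_fields_transpose a b Q : (forall h, Q h -> height a b h) ->
  (nb_fields a b Q <= nb_fields b a (fun h => Q (transpose h)))%N.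
Proof.
move=> Qh; rewrite !nb_fieldsE.
set A := (X in #|pred_of_set X|).
pose f (c : b.-tuple bool * a.-tuple (b.+1.-tuple bool)) := encode b a (transpose (decode c.1 c.2)).
have fK c : c \in A -> transpose (decode (f c).1 (f c).2) = decode c.1 c.2.
  rewrite inE => /asboolP /Qh /height_transpose ht; rewrite encodeK //.
  by move=> i j; rewrite andbC => ij; rewrite /transpose supported_decode.
rewrite -(card_in_imset (f := f) (D := A)); last first.
  move=> [y w] [y' w'] cA c'A fcc; rewrite -(decodeK y w) -(decodeK y' w').
  by have := fK _ cA; rewrite fcc (fK _ c'A) /= => ->.
apply: subset_leq_card; apply/fintype.subsetP => _ /imsetP[c cA ->]; rewrite inE; apply/asboolP.
by rewrite (fK c cA); move: cA; rewrite inE => /asboolP.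
Qed.

Lemma nb_fields_transpose a b Q : (forall h, Q h -> height a b h) ->
  nb_fields a b Q = nb_fields b a (fun h => Q (transpose h)).
Proof.
move=> Qh; apply/eqP; rewrite eqn_leq leq_nb_fields_transpose //=.
by apply: (@leq_nb_fields_transpose b a (fun h => Q (transpose h))) => h /Qh /height_transpose.
Qed.

(** The words coding the fields with property [Q] form, for each fixed top row [y],
a class to which [card_words] applies; the reduced words are then grouped by the
positions [phi] of their flat strips.  [Q] is indexed by the number of strips
because merging strips changes that number. *)
Lemma nb_fields_reduce (Q : nat -> (nat -> nat -> int) -> Prop) b B :
  (forall k a h h', row_dup k a b h h' -> Q a h <-> Q a.+1 h') ->
  (forall a h, Q a h -> row_reduced a b h -> (a <= B)%N) ->
  forall a, nb_fields a b (Q a) =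
    (\sum_(k < B.+1) \sum_(phi : k.-tuple bool) expansions a phi *
       nb_fields k b (fun h => [/\ Q k h, row_reduced k b h &
                                forall i : 'I_k, flat b h i = tnth phi i]))%N.
Proof.
move=> Qdup Qred a; rewrite /nb_fields.
pose L y (w : seq (b.+1.-tuple bool)) := `[< Q (size w) (decode y w) >].
transitivity (\sum_(y : b.-tuple bool) \sum_(w : a.-tuple (b.+1.-tuple bool)) L y w)%N.
  by apply: eq_bigr => y _; apply: eq_bigr => w _; rewrite /L size_tuple.
have Ldup (y : b.-tuple bool) w1 w2 x : level x ->
    L y (w1 ++ [:: x, x & w2]) = L y (w1 ++ x :: w2).
  move=> lx; apply/esym/asbool_equiv_eq.
  have -> : size (w1 ++ [:: x, x & w2]) = (size (w1 ++ x :: w2)).+1 by rewrite !size_cat /= !addnS.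
  exact: Qdup (row_dup_decode y w1 w2 lx).
have Lred (y : b.-tuple bool) w : L y w -> reduced (@level b) w -> (size w <= B)%N.
  by move=> /asboolP /Qred QB /row_reduced_decode -/(_ y) /QB.
under eq_bigr => y _ do rewrite (card_words a (Ldup y) (Lred y)).
rewrite exchange_big; apply: eq_bigr => k _.
under eq_bigr => y _.
  rewrite (partition_big (fun u : k.-tuple _ => map_tuple (@level b) u) predT) //=.
  over.
rewrite exchange_big; apply: eq_bigr => phi _; rewrite big_distrr; apply: eq_bigr => y _ /=.
rewrite big_distrr big_mkcond; apply: eq_bigr => u _ /=.
set C := _ && _; have CE : C = `[< [/\ Q k (decode y u), row_reduced k b (decode y u) &
    forall i : 'I_k, flat b (decode y u) i = tnth phi i] >].
  have red := row_reduced_decode y u; rewrite size_tuple in red.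
  have flags : (forall i : 'I_k, flat b (decode y u) i = tnth phi i) <->
      map_tuple (@level b) u = phi.
    have flagE (i : 'I_k) : flat b (decode y u) i = tnth (map_tuple (@level b) u) i.
      by rewrite flat_decode ?size_tuple // tnth_map (tnth_nth (blank b)).
    split=> [H|H i]; last by rewrite flagE H.
    by apply: eq_from_tnth => i; rewrite -H flagE.
  apply/idP/asboolP => [/andP[/andP[/asboolP + /red +] /eqP/flags]|[]].
    by rewrite size_tuple.
  by move=> Qk /red rk /flags fk; rewrite /C rk fk eqxx !andbT /L size_tuple; apply/asboolP.
rewrite -CE; case: ifP => [|_]; last by rewrite muln0.
by rewrite muln1 /C => /andP[_ /eqP <-].
Qed.

Definition with_extrema d a b h := height a b h /\ nb_extrema a b h = d.

Lemma with_extrema_transpose d a b h : with_extrema d a b h -> with_extrema d b a (transpose h).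
Proof. by case=> hP <-; split; [apply: height_transpose|rewrite nb_extrema_transpose]. Qed.

Lemma row_dup_with_extrema d k a b h h' : row_dup k a b h h' ->
  with_extrema d a b h <-> with_extrema d a.+1 b h'.
Proof.
move=> dup; have [hh' h'h] := row_dup_height dup.
split=> -[hP ne]; split; [exact: hh'|by rewrite (row_dup_nb_extrema dup)|exact: h'h|].
by rewrite -(row_dup_nb_extrema dup) //; apply: h'h.
Qed.

Lemma with_extrema_bound d a b h : with_extrema d a b h -> row_reduced a b h ->
  (a <= (3 * d).+1)%N.
Proof. by case=> hP <-; apply: row_reduced_bound. Qed.

(** The property obtained after reducing the rows, with the flat strips of the
reduced rows prescribed by [phi], is stable under repeating a flat vertical strip,
so the reduction applies again to the transposed fields.  [K phi psi] counts the
height functions reduced in both directions with given flat strips. *)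
Lemma nb_fields_with_extrema d : exists K : seq bool -> seq bool -> nat, forall a b,
  nb_fields a b (with_extrema d a b) =
  (\sum_(k < (3 * d).+2) \sum_(phi : k.-tuple bool) \sum_(l < (3 * d).+2)
     \sum_(psi : l.-tuple bool) K phi psi * expansions a phi * expansions b psi)%N.
Proof.
pose P k (phi : seq bool) b h := [/\ with_extrema d k b h, row_reduced k b h &
  forall i : 'I_k, flat b h i = nth false phi i].
pose P2 k phi l (psi : seq bool) h := [/\ P k phi l (transpose h), row_reduced l k h &
  forall i : 'I_l, flat k h i = nth false psi i].
exists (fun phi psi => nb_fields (size psi) (size phi) (P2 (size phi) phi (size psi) psi)) => a b.
rewrite (@nb_fields_reduce (fun a => with_extrema d a b) b (3 * d).+1); first last.
- by move=> ? ?; apply: with_extrema_bound.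
- by move=> k a' h h'; apply: row_dup_with_extrema.
apply: eq_bigr => k _; apply: eq_bigr => phi _.
rewrite (@eq_nb_fields _ _ _ (P k phi b)); last first.
  by move=> h; split=> -[? ? H]; split=> // i; rewrite H (tnth_nth false).
rewrite nb_fields_transpose; last by move=> h [[]].
rewrite (@nb_fields_reduce (fun l h => P k phi l (transpose h)) k (3 * d).+1); first last.
- by move=> l h [/with_extrema_transpose we _ _]; apply: with_extrema_bound we.
- move=> i l h h' dup; have top := row_dup_top dup; have fl := row_dup_flat dup.
  have we : with_extrema d k l (transpose h) <-> with_extrema d k l.+1 (transpose h').
    split=> /with_extrema_transpose /(row_dup_with_extrema d dup) /with_extrema_transpose //.
  have rr : row_reduced k l (transpose h) <-> row_reduced k l.+1 (transpose h').
    split=> H j jk; have jk' := ltnW jk; move: (H j jk).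
      by rewrite !fl // !top.
    by rewrite !fl // !top.
  split=> -[/we ? /rr ? H]; split=> // j.
    by rewrite fl.
  by rewrite -H fl.
rewrite big_distrr; apply: eq_bigr => l _; rewrite big_distrr; apply: eq_bigr => psi _ /=.
rewrite !size_tuple mulnA mulnC mulnA; congr (_ * _ * _)%N.
by apply: eq_nb_fields => h; split=> -[? ? H]; split=> // i; rewrite H (tnth_nth false).
Qed.

(** * From height functions on the grid to words *)

Definition to_ffun a b (h : nat -> nat -> int) : {ffun cell a.+1 b.+1 -> int} :=
  [ffun u : cell a.+1 b.+1 => h u.1 u.2].

Lemma to_ffun_height a b h : height a b h <-> is_height_function (to_ffun a b h).
Proof.
split=> [[h0 hv hh]|[step h0]].
  split=> [[[i /= ia] [j /= jb]] [[i' /= ia'] [j' /= jb']]|[[i /= ia] [j /= jb]]].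
    rewrite /grid_adj /consecutive !ffunE -!val_eqE /=.
    move=> /orP[/andP[/eqP <- /orP[/eqP e|/eqP e]]|/andP[/orP[/eqP e|/eqP e] /eqP <-]]; subst => //.
    - by rewrite distrC hh.
    - by rewrite hh.
    - by rewrite distrC hv.
    - by rewrite hv.
  by rewrite ffunE /= => -> ->.
split=> [|i j ia jb|i j ia jb].
- by have := h0 (ord0, ord0) erefl erefl; rewrite ffunE.
- have ia' := leqW ia.
  have := step (Ordinal (ia : (i.+1 < a.+1)%N), Ordinal (jb : (j < b.+1)%N))
               (Ordinal (ia' : (i < a.+1)%N), Ordinal (jb : (j < b.+1)%N)).
  by rewrite !ffunE /= /grid_adj /consecutive !eqxx /= !orbT => ->.
- have jb' := leqW jb.
  have := step (Ordinal (ia : (i < a.+1)%N), Ordinal (jb : (j.+1 < b.+1)%N))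
               (Ordinal (ia : (i < a.+1)%N), Ordinal (jb' : (j < b.+1)%N)).
  by rewrite !ffunE /= /grid_adj /consecutive !eqxx /= !orbT => ->.
Qed.

Lemma to_ffun_apex a b h s (u : cell a.+1 b.+1) :
  [forall v : cell a.+1 b.+1, grid_adj u v ==> (to_ffun a b h v == to_ffun a b h u + s)] =
  apex a b h s u.1 u.2.
Proof.
case: u => [[i ia] [j jb]]; rewrite /apex /grid_adj /consecutive ffunE /=.
apply/forallP/and4P => [H|[up down left right] [[i' ia'] [j' jb']]].
  have nb i' j' (ia' : (i' < a.+1)%N) (jb' : (j' < b.+1)%N) := H (Ordinal ia', Ordinal jb').
  split; apply/implyP => ij.
  - have ia' : (i.-1 < a.+1)%N by rewrite (leq_ltn_trans (leq_pred _)).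
    by have := nb _ _ ia' jb; rewrite !ffunE -!val_eqE /= !eqxx prednK // eqxx orbT andbT orbT.
  - by have := nb i.+1 _ ij jb; rewrite !ffunE -!val_eqE /= !eqxx andbT orbT.
  - have jb' : (j.-1 < b.+1)%N by rewrite (leq_ltn_trans (leq_pred _)).
    by have := nb _ _ ia jb'; rewrite !ffunE -!val_eqE /= !eqxx prednK // eqxx orbT.
  - by have := nb _ j.+1 ia ij; rewrite !ffunE -!val_eqE /= !eqxx.
rewrite !ffunE -!val_eqE /=; apply/implyP.
move=> /orP[/andP[/eqP <- /orP[/eqP e|/eqP e]]|/andP[/orP[/eqP e|/eqP e] /eqP <-]]; subst.
- by move: right; rewrite -ltnS jb'.
- by move: left.
- by move: down; rewrite -ltnS ia'.
- by move: up.
Qed.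

Lemma to_ffun_extrema a b h : #|extrema (to_ffun a b h)| = nb_extrema a b h.
Proof.
rewrite /nb_extrema pair_big /= -sum1_card big_mkcond; apply: eq_bigr => u _ /=.
by rewrite inE /is_local_min /is_local_max !to_ffun_apex /extremal; case: (_ || _).
Qed.

Lemma E_nb_fields d a b : E d a.+1 b.+1 = nb_fields a b (with_extrema d a b).
Proof.
rewrite nb_fieldsE /E; set A := (X in _ = #|pred_of_set X|).
pose f (c : b.-tuple bool * a.-tuple (b.+1.-tuple bool)) := to_ffun a b (decode c.1 c.2).
have of_ffun (g : {ffun cell a.+1 b.+1 -> int}) : exists2 h, supported a b h & g = to_ffun a b h.
  exists (fun i j => if (i <= a)%N && (j <= b)%N then g (inord i, inord j) else 0).
    by move=> i j /negbTE ->.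
  by apply/ffunP => [[i j]]; rewrite ffunE /= !leq_ord /= !inord_val.
have E1 : height_functions_with d a.+1 b.+1 = [set` [fset f c | c in A]%fset]%classic.
  apply/seteqP; split=> [g [gh ge]|g /imfsetP[c]] /=.
    have [h supp gE] := of_ffun g; rewrite {}gE in gh ge *.
    move: gh ge; rewrite -to_ffun_height to_ffun_extrema => gh ge.
    apply/imfsetP; exists (encode a b h); last by rewrite /f encodeK.
    by rewrite /= inE; apply/asboolP; rewrite encodeK.
  rewrite inE => /asboolP[hP <-] ->.
  by split; [apply/to_ffun_height|rewrite to_ffun_extrema].
rewrite E1 {E1} set_fsetK card_in_imfset ?cardE //=.
move=> [y w] [y' w'] _ _ /ffunP fE; rewrite -(decodeK y w) -(decodeK y' w').
congr encode; apply/funext => i; apply/funext => j.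
have [/andP[ia jb]|ij] := boolP ((i <= a)%N && (j <= b)%N).
  by have := fE (Ordinal (ia : (i < a.+1)%N), Ordinal (jb : (j < b.+1)%N)); rewrite !ffunE.
by rewrite !supported_decode.
Qed.

(** * The number of expansions is eventually polynomial *)

Definition falling (n : nat) : {poly rat} := \prod_(i < n) ('X - (i%:R)%:P).

Lemma fallingB n x : (falling n.+1).[x + 1] - (falling n.+1).[x] = n.+1%:R * (falling n).[x].
Proof.
rewrite {2}/falling big_ord_recr -/(falling n) /= hornerM hornerXsubC.
suff -> : (falling n.+1).[x + 1] = (x + 1) * (falling n).[x] by rewrite -(natr1 n); ring.
rewrite /falling !horner_prod big_ord_recl hornerXsubC subr0; congr (_ * _).
by apply: eq_bigr => i _; rewrite !hornerXsubC /= /bump /= add1n -natr1; ring.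
Qed.

(** The falling factorials have antidifferences and, being monic of every degree,
allow the leading terms of [p] to be removed one by one. *)
Lemma poly_antidifference (p : {poly rat}) : exists q : {poly rat}, forall x,
  q.[x + 1] - q.[x] = p.[x].
Proof.
have [n] : {n | (size p <= n)%N} by exists (size p).
elim: n p => [|n IH] p pn.
  by exists 0 => x; move: pn; rewrite leqn0 size_poly_eq0 => /eqP ->; rewrite !horner0 subrr.
have sf : size (falling n) = n.+1.
  by rewrite /falling size_prod_XsubC /index_enum -enumT size_enum_ord.
have mf : (falling n)`_n = 1.
  have /monicP : falling n \is monic by apply: monic_prod_XsubC.
  by rewrite lead_coefE sf.
have [|q qE] := IH (p - p`_n *: falling n).
  apply/leq_sizeP => j nj; rewrite coefB coefZ; have [->|jn] := eqVneq j n.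
    by rewrite mf mulr1 subrr.
  have nj' : (n < j)%N by rewrite ltn_neqAle eq_sym jn.
  by rewrite (nth_default _ (leq_trans pn nj')) [_`_j]nth_default ?sf // mulr0 subr0.
exists (q + (p`_n / n.+1%:R) *: falling n.+1) => x.
rewrite !hornerD !hornerZ opprD addrACA qE -mulrBr fallingB mulrA divfK ?pnatr_eq0 //.
by rewrite hornerD hornerN hornerZ subrK.
Qed.

Definition integer_valued (p : {poly rat}) := forall z : int, p.[z%:~R] \is a Num.int.

(** Starting from the value of [q] at [z0], one reaches its value at every
integer by adding or subtracting values of [p]. *)
Lemma integer_valued_antidifference (p q : {poly rat}) (z0 : int) :
  (forall x, q.[x + 1] - q.[x] = p.[x]) -> integer_valued p -> q.[z0%:~R] \is a Num.int ->
  integer_valued q.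
Proof.
move=> qE pZ q0 z; rewrite -[z](subrK z0) addrC.
elim: (z - z0) => [|n IH|n IH]; first by rewrite addr0.
  rewrite -addn1 PoszD addrA intrD.
  by rewrite -[X in X \is a _](subrK q.[(z0 + n)%:~R]) qE rpredD.
have := qE (z0 - n.+1%:Z)%:~R; rewrite -[_ + 1](intrD _ _ 1).
rewrite (_ : z0 - n.+1%:Z + 1 = z0 - n%:Z) => [E|]; last by rewrite -addn1 PoszD; ring.
rewrite (_ : q.[_] = q.[(z0 - n%:Z)%:~R] - p.[(z0 - n.+1%:Z)%:~R]) ?rpredB //.
by rewrite -E subKr.
Qed.

(** Putting in front of [phi] a letter that is not repeatable shifts the length by
one; a repeatable letter gives the function of the length whose difference is the
polynomial of [phi].  Integer values at all integers, negative ones included, are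
needed because a quasi-polynomial is integer-valued everywhere. *)
Lemma expansions_polynomial (phi : seq bool) : exists2 p : {poly rat}, integer_valued p &
  forall l, (size phi < l)%N -> (expansions l phi)%:R = p.[l%:R].
Proof.
elim: phi => [|[] phi [p pZ pE]].
- by exists 0 => [z|[|l]] //; rewrite horner0 // rpred0.
- have [q qE] := poly_antidifference p; pose l0 := (size phi).+1.
  pose c := (expansions l0 (true :: phi))%:R - q.[l0%:R].
  have q'E x : (q + c%:P).[x + 1] - (q + c%:P).[x] = p.[x].
    by rewrite !hornerD !hornerC opprD addrACA subrr addr0 qE.
  have q'0 : (q + c%:P).[l0%:R] = (expansions l0 (true :: phi))%:R.
    by rewrite hornerD hornerC addrC subrK.
  exists (q + c%:P).
    apply: (integer_valued_antidifference (z0 := l0) q'E) => //.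
    by rewrite -pmulrn q'0 rpred_nat.
  suff H l : (l0 <= l)%N -> (expansions l (true :: phi))%:R = (q + c%:P).[l%:R].
    by move=> l /ltnW; apply: H.
  elim: l => // l IH; rewrite leq_eqVlt => /orP[/eqP <- //|]; rewrite ltnS => l0l.
  rewrite -[in RHS]natr1 -[RHS](subrK (q + c%:P).[l%:R]) q'E -IH // -pE //.
  by rewrite -natrD.
- exists (p \Po ('X - 1)) => [z|[|l] //= l0].
    by rewrite horner_comp hornerD hornerX hornerN hornerC -[_ - 1](intrB _ z 1).
  by rewrite addn0 horner_comp hornerD hornerX hornerN hornerC -natr1 addrK pE.
Qed.

(** * Cutting the quadrant into regions *)

Definition univariate (i : 'I_2) (p : {poly rat}) : {mpoly rat[2]} :=
  \sum_(j < size p) p`_j *: 'X_i ^+ j.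

Lemma meval_univariate i p v : (univariate i p).@[v] = p.[v i].
Proof.
rewrite /univariate raddf_sum horner_coef; apply: eq_bigr => j _ /=.
by rewrite mevalZ rmorphXn /= mevalXU.
Qed.

Definition eval_int (P : {mpoly rat[2]}) (z : 'rV[int]_2) : rat := P.@[fun i => (z 0 i)%:~R].

Lemma quasi_polynomial_floor (P : {mpoly rat[2]}) :
  (forall z, eval_int P z \is a Num.int) -> quasi_polynomial (fun z => Num.floor (eval_int P z)).
Proof. by move=> PZ; exists 1%N => // r; exists P => z _; rewrite floorK. Qed.

(** Each half-line [1 <= x] is cut into the pieces [s + 1 <= x < s + 2] for [s < M],
which contain one integer each, and the last piece [M + 1 <= x]. *)
Section Pieces.
Variables (R : realType) (M : nat).

Definition in_piece (s : nat) (x : R) : bool :=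
  (s.+1%:R <= x) && ((s < M)%N ==> (x < s.+2%:R)).

Definition coord_ineqs (i : 'I_2) (s : nat) : seq (linear_inequality R 2) :=
  LinearInequality (- delta_mx 0 i) (- s.+1%:R) true ::
  (if (s < M)%N then [:: LinearInequality (delta_mx 0 i) s.+2%:R false] else [::]).

Lemma satisfies_coord_ineqs i s (x : 'rV[R]_2) :
  all (fun c => satisfies c x) (coord_ineqs i s) = in_piece s (x 0 i).
Proof.
have dE : \sum_(j < 2) (delta_mx 0 i : 'rV[R]_2) 0 j * x 0 j = x 0 i.
  rewrite (bigD1 i) //= big1 ?addr0 => [|j /negbTE ji]; first by rewrite mxE !eqxx mul1r.
  by rewrite mxE ji andbF mul0r.
rewrite /coord_ineqs /in_piece /= /satisfies /=; congr (_ && _).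
  under eq_bigr => j _ do rewrite mxE mulNr.
  by rewrite sumrN dE lerN2.
by case: ifP => //= _; rewrite dE andbT.
Qed.

Lemma in_piece_exists x : 1 <= x -> exists s : 'I_M.+1, in_piece s x.
Proof.
move=> x1; have /andP[lo hi] := truncn_itv (le_trans ler01 x1).
have n0 : (0 < Num.truncn x)%N by rewrite truncn_gt0.
have sM : (minn (Num.truncn x).-1 M < M.+1)%N by rewrite ltnS geq_minr.
exists (Ordinal sM); rewrite /in_piece /=; apply/andP; split.
  by apply: le_trans lo; rewrite ler_nat -[leqRHS](prednK n0) ltnS geq_minl.
apply/implyP => lt; apply: lt_le_trans hi _; rewrite ler_nat.
by move: lt; rewrite /minn; case: ifP => _; rewrite ?ltnn // ltnS prednK.
Qed.

Lemma in_piece_unique x (s t : 'I_M.+1) : in_piece s x -> in_piece t x -> s = t.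
Proof.
suff H (u v : 'I_M.+1) : in_piece u x -> in_piece v x -> ~~ (u < v)%N.
  move=> sx tx; apply/val_inj/eqP; rewrite eqn_leq.
  by rewrite leqNgt (H _ _ tx sx) leqNgt (H _ _ sx tx).
move=> /andP[_ /implyP ux] /andP[vx _]; apply/negP => uv.
have /ux lt : (u < M)%N by rewrite (leq_trans uv) // -ltnS.
have : x < x by apply: lt_le_trans lt (le_trans _ vx); rewrite ler_nat ltnS.
by rewrite ltxx.
Qed.

Lemma in_piece_int (s : 'I_M.+1) (a : nat) : in_piece s a.+1%:R ->
  (s <= a)%N /\ ((s < M)%N -> a = s).
Proof.
rewrite /in_piece ler_nat ltr_nat !ltnS => /andP[sa /implyP aM]; split=> // /aM.
by move=> as'; apply/eqP; rewrite eqn_leq sa as'.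
Qed.

End Pieces.

(** On a piece with a single integer point a constant does; the last piece lies
beyond the threshold of [expansions_polynomial].  The argument of the polynomials
is the number of rows, one more than the number of strips. *)
Lemma expansions_on_piece (R : realType) (M : nat) (s : 'I_M.+1) (phi : seq bool) :
  (size phi < M)%N -> exists2 p : {poly rat}, integer_valued p &
  forall a : nat, in_piece M s (a.+1%:R : R) -> (expansions a phi)%:R = p.[a.+1%:R].
Proof.
move=> phiM; have [sM|Ms] := ltnP s M.
  exists (expansions s phi)%:R%:P => [z|a /in_piece_int[_ /(_ sM) ->]]; last by rewrite hornerC.
  by rewrite hornerC rpred_nat.
have [p pZ pE] := expansions_polynomial phi.
exists (p \Po ('X - 1)) => [z|a /in_piece_int[sa _]].
  by rewrite horner_comp hornerD hornerX hornerN hornerC -[_ - 1](intrB _ z 1).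
rewrite horner_comp hornerD hornerX hornerN hornerC -natr1 addrK pE //.
exact: leq_trans phiM (leq_trans Ms sa).
Qed.

Theorem theorem6p1 (R : realType) (d : nat) (hd : (2 <= d)%N) :
  piecewise_quasi_polynomial_on (ge1_quadrant R)
    (fun z : 'rV[int]_2 => (E d (absz (z 0 0)) (absz (z 0 1)))%:Z).
Proof.
have [K KE] := nb_fields_with_extrema d; pose M := (3 * d).+2.
pose pieces (st : 'I_M.+1 * 'I_M.+1) := coord_ineqs R M 0 st.1 ++ coord_ineqs R M 1 st.2.
have piecesE st x : region (pieces st) x <-> in_piece M st.1 (x 0 0) && in_piece M st.2 (x 0 1).
  by rewrite /region /mkset all_cat !satisfies_coord_ineqs; split.
exists #|{: 'I_M.+1 * 'I_M.+1}|; exists (fun i => pieces (enum_val i)); split.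
  move=> x [/(in_piece_exists M)[s sx] /(in_piece_exists M)[t tx]].
  exists (enum_rank (s, t)); split; first by apply/piecesE; rewrite enum_rankK sx tx.
  move=> i /piecesE /andP[s'x t'x]; rewrite -[i]enum_valK; congr enum_rank.
  rewrite [enum_val i]surjective_pairing.
  by congr pair; [apply: in_piece_unique sx _|apply: in_piece_unique tx _].
move=> i; case: (enum_val i) => s t {i}.
have local (u : 'I_M.+1) : exists F : seq bool -> {poly rat}, forall phi, (size phi < M)%N ->
    integer_valued (F phi) /\
    forall a : nat, in_piece M u (a.+1%:R : R) -> (expansions a phi)%:R = (F phi).[a.+1%:R].
  have [phi|F FP] := @choice _ _ (fun phi p => (size phi < M)%N -> integer_valued p /\
    forall a : nat, in_piece M u (a.+1%:R : R) -> (expansions a phi)%:R = p.[a.+1%:R]);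
    last by exists F.
  have [phiM|_] := ltnP (size phi) M; last by exists 0.
  by have [p pZ pE] := expansions_on_piece R u phiM; exists p.
(* [F] and [G] give, for each pattern of flat strips, the polynomials that count
   expansions on the pieces [s] of the first axis and [t] of the second. *)
have [F FE] := local s; have [G GE] := local t.
pose P : {mpoly rat[2]} := \sum_(k < M) \sum_(phi : k.-tuple bool) \sum_(l < M)
  \sum_(psi : l.-tuple bool) (K phi psi)%:R *: (univariate 0 (F phi) * univariate 1 (G psi)).
have PE z : eval_int P z = \sum_(k < M) \sum_(phi : k.-tuple bool) \sum_(l < M)
    \sum_(psi : l.-tuple bool) (K phi psi)%:R * ((F phi).[(z 0 0)%:~R] * (G psi).[(z 0 1)%:~R]).
  rewrite /eval_int /P; do 4 (rewrite raddf_sum; apply: eq_bigr => ? _).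
  by rewrite /= mevalZ rmorphM /= !meval_univariate.
have PZ z : eval_int P z \is a Num.int.
  rewrite PE; apply: rpred_sum => k _; apply: rpred_sum => phi _.
  apply: rpred_sum => l _; apply: rpred_sum => psi _.
  have [FZ _] := FE phi ltac:(by rewrite size_tuple).
  have [GZ _] := GE psi ltac:(by rewrite size_tuple).
  by rewrite !rpredM ?rpred_nat.
exists (fun z => Num.floor (eval_int P z)); first exact: quasi_polynomial_floor.
move=> z [z0 z1] /piecesE; move: z0 z1; rewrite /= !mxE -[1]/(1%:~R) !ler_int => z0 z1.
have [a za] : {a : nat | z 0 0 = a.+1} by exists (absz (z 0 0)).-1; lia.
have [b zb] : {b : nat | z 0 1 = b.+1} by exists (absz (z 0 1)).-1; lia.
rewrite za zb -!pmulrn => /andP[sa tb].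
apply: (@intr_inj rat); rewrite floorK // PE za zb -!pmulrn !absz_nat E_nb_fields KE.
rewrite natr_sum; apply: eq_bigr => k _; rewrite natr_sum; apply: eq_bigr => phi _.
rewrite natr_sum; apply: eq_bigr => l _; rewrite natr_sum; apply: eq_bigr => psi _.
have [_ FE'] := FE phi ltac:(by rewrite size_tuple).
have [_ GE'] := GE psi ltac:(by rewrite size_tuple).
by rewrite !natrM -mulrA FE' // GE'.
Qed.
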